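(* Let $(X,f_{1,\infty})$ be a nonautonomous dynamical system, and let $K$ be a nonempty subset of $X$. Then for any $k\in\mathbb{N}$, $$\overline{D}_K(f_{1,\infty}^k)\le\overline{D}_K(f_{1,\infty}),\qquad \underline{D}_K(f_{1,\infty}^k)\le\underline{D}_K(f_{1,\infty}).$$
   Context: $\mathbb{N}=\{1,2,\dots\}$. A nonautonomous dynamical system $(X,f_{1,\infty})$ consists of a compact topological space $X$ and a sequence $f_{1,\infty}=(f_i)_{i\ge 1}$ of continuous maps $f_i:X\to X$. Put $f_i^0=\mathrm{id}_X$ and $f_i^j=f_{i+j-1}\circ\cdots\circ f_{i+1}\circ f_i$. For $k\in\mathbb{N}$, $f_{1,\infty}^k$ denotes the sequence of maps $(f_1^k,f_{k+1}^k,f_{2k+1}^k,\dots)$. Upper and lower topological entropy dimension of a sequence $g_{1,\infty}=(g_i)_{i\ge1}$ of continuous selfmaps of $X$ on nonempty $K\subseteq X$ (applied above to $g_{1,\infty}=f_{1,\infty}$ and $f_{1,\infty}^k$). Put $g_1^0=\mathrm{id}_X$, $g_1^j=g_j\circ\cdots\circ g_1$. For a finite open cover $\mathcal{U}$ of $X$ let $\mathcal{U}_1^n$ be the cover of all sets $\bigcap_{j=0}^{n-1}(g_1^j)^{-1}(U_j)$ with $U_j\in\mathcal{U}$, and let $\mathcal{N}(\mathcal{U}_1^n|_K)$ be the minimal number of members of $\{V\cap K: V\in\mathcal{U}_1^n\}$ needed to cover $K$. For $s>0$ set $\overline{h}_K(g_{1,\infty},s)=\sup_{\mathcal{U}}\limsup_{n\to\infty}\frac{1}{n^s}\log\mathcal{N}(\mathcal{U}_1^n|_K)$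 and $\underline{h}_K(g_{1,\infty},s)=\sup_{\mathcal{U}}\liminf_{n\to\infty}\frac{1}{n^s}\log\mathcal{N}(\mathcal{U}_1^n|_K)$, suprema over all finite open covers of $X$. Then $\overline{D}_K(g_{1,\infty})=\inf\{s>0:\overline{h}_K(g_{1,\infty},s)=0\}=\sup\{s>0:\overline{h}_K(g_{1,\infty},s)=\infty\}$ and $\underline{D}_K(g_{1,\infty})=\inf\{s>0:\underline{h}_K(g_{1,\infty},s)=0\}=\sup\{s>0:\underline{h}_K(g_{1,\infty},s)=\infty\}$, with $\inf\emptyset=+\infty$ and $\sup\emptyset=0$. *)

(* Defs.v *)
From HB Require Import structures.
From mathcomp Require Import all_boot all_order all_algebra.
From mathcomp Require Import all_classical all_reals all_analysis.

Set Implicit Arguments.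
Unset Strict Implicit.
Unset Printing Implicit Defensive.

Import Order.TTheory GRing.Theory Num.Theory.
Import numFieldNormedType.Exports.

Local Open Scope classical_set_scope.
Local Open Scope ring_scope.

(* Sequences of maps are indexed from 0: [f i] stands for f_{i+1}. *)

(* [nds_iter f i j] is f_{i+1}^j = f_{i+j} o ... o f_{i+1}. *)
Fixpoint nds_iter (X : Type) (f : nat -> X -> X) (i j : nat) : X -> X :=
  if j is j'.+1 then f (i + j')%N \o nds_iter f i j' else id.

(* The sequence (f_1^k, f_{k+1}^k, f_{2k+1}^k, ...). *)
Definition nds_power (X : Type) (f : nat -> X -> X) (k : nat) : nat -> X -> X :=
  fun i => nds_iter f (i * k)%N k.

Definition finite_open_cover (X : topologicalType) : set (set (set X)) :=
  [set U | [/\ finite_set U, U `<=` open & \bigcup_(A in U) A = setT]].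

Definition iterated_cover (X : Type) (g : nat -> X -> X) (U : set (set X))
    (n : nat) : set (set X) :=
  [set V | exists2 c : nat -> set X,
     (forall j, (j < n)%N -> U (c j)) &
     V = \bigcap_(j in `I_n) (nds_iter g 0 j @^-1` c j)].

Definition covering_card (X : Type) (C : set (set X)) (K : set X) : set nat :=
  [set m | exists S : set (set X),
     [/\ S `<=` [set V `&` K | V in C], (S #= `I_m)%card & K `<=` \bigcup_(A in S) A]].

(* The default value 0 is only reached when no finite subfamily covers K. *)
Definition min_covering (X : Type) (C : set (set X)) (K : set X) : nat :=
  xget 0%N [set m | covering_card C K m /\
                    forall m', covering_card C K m' -> (m <= m')%N].

(* The value at n = 0 is irrelevant for the limits superior and inferior. *)
Definition cover_growth (R : realType) (X : topologicalType) (K : set X)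
    (g : nat -> X -> X) (s : R) (U : set (set X)) (n : nat) : \bar R :=
  ((n%:R `^ s)^-1 * ln (min_covering (iterated_cover g U n) K)%:R)%:E.

Definition upper_entropy (R : realType) (X : topologicalType) (K : set X)
    (g : nat -> X -> X) (s : R) : \bar R :=
  ereal_sup [set limn_esup (cover_growth K g s U) | U in @finite_open_cover X].

Definition lower_entropy (R : realType) (X : topologicalType) (K : set X)
    (g : nat -> X -> X) (s : R) : \bar R :=
  ereal_sup [set limn_einf (cover_growth K g s U) | U in @finite_open_cover X].

(* The infimum of the empty set is +oo here. The values of s with infinite
   entropy have the same threshold, since finite entropy at s > 0 forces zero
   entropy at every t > s. *)
Definition upper_entropy_dim (R : realType) (X : topologicalType) (K : set X)
    (g : nat -> X -> X) : \bar R :=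
  ereal_inf [set s%:E | s in [set s : R | 0 < s /\ upper_entropy K g s = 0%E]].

Definition lower_entropy_dim (R : realType) (X : topologicalType) (K : set X)
    (g : nat -> X -> X) : \bar R :=
  ereal_inf [set s%:E | s in [set s : R | 0 < s /\ lower_entropy K g s = 0%E]].

(* Main.v *)
Require Import Defs.
From mathcomp Require Import all_boot all_order all_algebra.
From mathcomp Require Import all_classical all_reals all_analysis.

Set Implicit Arguments.
Unset Strict Implicit.
Unset Printing Implicit Defensive.

Import Order.TTheory GRing.Theory Num.Theory.
Import numFieldNormedType.Exports.

Local Open Scope classical_set_scope.
Local Open Scope ring_scope.

(** Both dimensions are infima of sets of exponents s at which an entropy
    vanishes, so it is enough that the vanishing of the entropy of f at s forces
    that of g := f_{1,oo}^k.

    The j-th iterate of g is the (j k)-th iterate of f. Hence a member of the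
    cover U_1^m for f, with n k <= m, lies in the member of U_1^n for g that
    keeps only the constraints at times 0, k, 2k, ..., (n-1) k. Passing to a
    coarser cover does not increase the number of members needed, so
    N(U_1^n, g) <= N(U_1^m, f) (iterated_cover_refines, min_covering_refines).
    If in addition m <= 2 k n, normalising by n^s instead of m^s costs at most
    the factor (2k)^s, which does not depend on n (cover_growth_power):

      n^{-s} log N(U_1^n, g) <= (2k)^s m^{-s} log N(U_1^m, f).

    The two entropies use this inequality with different m. A limit superior is
    handled by m = n k: the growth rates of f are small at all large times, in
    particular at multiples of k. A limit inferior only provides some large
    times m at which the growth rate of f is small, and these need not be
    multiples of k; there one takes n to be the integer part of m / k, and the
    factor 2 pays for the rounding. *)

(** * Iterates and covers *)

Lemma nds_iter_add (X : Type) (f : nat -> X -> X) (i a b : nat) :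
  nds_iter f i (a + b) = nds_iter f (i + a) b \o nds_iter f i a.
Proof.
elim: b => [|b IHb]; first by rewrite addn0.
by rewrite addnS /= IHb addnA.
Qed.

Lemma nds_iter_power (X : Type) (f : nat -> X -> X) (k n : nat) :
  nds_iter (nds_power f k) 0 n = nds_iter f 0 (n * k).
Proof.
elim: n => [//|n IHn].
by rewrite mulSn addnC nds_iter_add /= IHn.
Qed.

Definition refines (X : Type) (C D : set (set X)) :=
  forall V, C V -> exists2 W, D W & V `<=` W.

(** Allowing any m above n k, and not only m = n k, also records that the
    covering numbers of f are nondecreasing in time. *)
Lemma iterated_cover_refines (X : Type) (f : nat -> X -> X) (U : set (set X))
    (k n m : nat) : (0 < k)%N -> (n * k <= m)%N ->
  refines (iterated_cover f U m) (iterated_cover (nds_power f k) U n).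
Proof.
move=> k_gt0 nkm _ [c cU ->].
have lt_m j : (j < n)%N -> (j * k < m)%N.
  by move=> jn; apply: leq_trans nkm; rewrite ltn_pmul2r.
exists (\bigcap_(j in `I_n) (nds_iter (nds_power f k) 0 j @^-1` c (j * k)%N)).
  by exists (fun j => c (j * k)%N) => // j /lt_m; apply: cU.
move=> x cx j jn /=; rewrite nds_iter_power.
exact: cx (lt_m j jn).
Qed.

(** * Covering numbers *)

(** Enlarging each member of a subcover to a member of the coarser family still
    covers K. Distinct members may be enlarged to the same set, so the size of
    the new subcover is only bounded. *)
Lemma covering_card_refines (X : Type) (C D : set (set X)) (K : set X) m :
  refines C D -> covering_card C K m ->
  exists2 m', covering_card D K m' & (m' <= m)%N.
Proof.
move=> CD [S [SC Sm KS]].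
have /choice[b bP] A : exists B, S A ->
    [set V `&` K | V in D] B /\ A `<=` B.
  have [SA|nSA] := pselect (S A); last by exists A.
  have [V CV <-] := SC _ SA.
  have [W DW VW] := CD _ CV.
  exists (W `&` K) => _; split; first by exists W.
  exact: setSI.
have bSm : (b @` S #<= `I_m)%card.
  by apply: card_le_trans (card_image_le b S) _; rewrite (card_le_eql Sm).
have /finite_setP[m' bSm'] : finite_set (b @` S).
  by apply/finite_set_leP; exists m.
exists m'; last by rewrite -card_le_II -(card_le_eql bSm').
exists (b @` S); split => //.
- by move=> _ [A SA <-]; have [] := bP A SA.
- move=> x /KS[A SA Ax]; exists (b A); first by exists A.
  by have [_] := bP A SA; apply.
Qed.

(** A finite subcover has to be exhibited before [min_covering] has its intended
    meaning: its default value 0 would make comparisons fail. *)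
Lemma min_coveringP (X : Type) (C : set (set X)) (K : set X) m :
  covering_card C K m ->
  covering_card C K (min_covering C K) /\
  forall m', covering_card C K m' -> (min_covering C K <= m')%N.
Proof.
move=> Cm; rewrite /min_covering.
case: xgetP => [_ _ //|] /(_ _) none; exfalso.
have ex : exists m, `[< covering_card C K m >] by exists m; apply/asboolP.
case: (ex_minnP ex) => m0 /asboolP Cm0 m0_min.
by apply: (none m0); split=> // m' Cm'; apply: m0_min; apply/asboolP.
Qed.

Lemma min_covering_refines (X : Type) (C D : set (set X)) (K : set X) m :
  refines C D -> covering_card C K m ->
  (min_covering D K <= min_covering C K)%N.
Proof.
move=> CD /min_coveringP[/(covering_card_refines CD)[m' Dm' m'_le] _].
by apply: leq_trans m'_le; have [_] := min_coveringP Dm'; apply.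
Qed.

(** Each additional time intersects the members found so far with the preimages
    of the finitely many members of U. *)
Lemma iterated_cover_finite (X : Type) (g : nat -> X -> X) (U : set (set X)) n :
  finite_set U -> finite_set (iterated_cover g U n).
Proof.
move=> finU; elim: n => [|n IHn].
  apply: (@sub_finite_set _ _ [set setT]); last exact: finite_set1.
  by move=> _ [c _ ->]; rewrite /= II0 bigcap_set0.
pose h V A := V `&` (nds_iter g 0 n @^-1` A).
apply: sub_finite_set (finite_image2 h IHn finU) => _ [c cU ->].
exists (\bigcap_(j in `I_n) (nds_iter g 0 j @^-1` c j)).
  by exists c => // j jn; apply: cU; apply: leqW.
exists (c n); first exact: cU.
by rewrite /h IIS bigcap_setU bigcap_set1.
Qed.

Lemma iterated_cover_covering_card (X : topologicalType) (g : nat -> X -> X)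
    (U : set (set X)) (K : set X) n :
  finite_open_cover U -> exists m, covering_card (iterated_cover g U n) K m.
Proof.
move=> [finU _ covU].
have /finite_setP[m Sm] : finite_set [set V `&` K | V in iterated_cover g U n].
  exact/finite_image/iterated_cover_finite.
exists m, [set V `&` K | V in iterated_cover g U n]; split => // x Kx.
have /choice[c cP] j : exists A, U A /\ A (nds_iter g 0 j x).
  have : [set: X] (nds_iter g 0 j x) by [].
  by rewrite -covU => -[A UA Ax]; exists A.
pose V := \bigcap_(j in `I_n) (nds_iter g 0 j @^-1` c j).
exists (V `&` K).
  by exists V => //; exists c => // j _; have [] := cP j.
by split=> // j _; have [] := cP j.
Qed.

(** * Growth rates *)

Lemma ln_nat_ge0 (R : realType) (n : nat) : 0 <= ln n%:R :> R.
Proof. by case: n => [|n]; [rewrite ln0 | rewrite ln_ge0 ?ler1n]. Qed.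

Lemma cover_growth_ge0 (R : realType) (X : topologicalType) (K : set X)
    (g : nat -> X -> X) (s : R) (U : set (set X)) (n : nat) :
  (0 <= cover_growth K g s U n)%E.
Proof. by rewrite lee_fin mulr_ge0 ?invr_ge0 ?powR_ge0 ?ln_nat_ge0. Qed.

(** The common estimate behind both entropies: n k <= m compares the covering
    numbers, and m <= 2 k n compares the normalisations n^s and m^s. *)
Lemma cover_growth_power (R : realType) (X : topologicalType) (K : set X)
    (f : nat -> X -> X) (s : R) (U : set (set X)) (k n m : nat) :
  finite_open_cover U -> 0 <= s -> (0 < k)%N -> (0 < n)%N ->
  (n * k <= m <= n * (2 * k))%N ->
  (cover_growth K (nds_power f k) s U n
   <= ((2 * k)%:R `^ s)%:E * cover_growth K f s U m)%E.
Proof.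
move=> covU s_ge0 k_gt0 n_gt0 /andP[nkm mn2k].
have m_gt0 : (0 < m)%N by apply: leq_trans nkm; rewrite muln_gt0 n_gt0.
rewrite -EFinM lee_fin mulrA; apply: ler_pM.
- by rewrite invr_ge0 powR_ge0.
- exact: ln_nat_ge0.
- rewrite ler_pdivlMr ?powR_gt0 ?ltr0n// mulrC.
  rewrite ler_pdivrMr ?powR_gt0 ?ltr0n// -powRM// -natrM.
  by rewrite ge0_ler_powR ?nnegrE// ler_nat mulnC.
- have [p fp] := iterated_cover_covering_card f K m covU.
  have le_min := min_covering_refines (iterated_cover_refines (f := f)
    (U := U) k_gt0 nkm) fp.
  (* [ln] is monotone on positive numbers only; the value 0 is separate. *)
  move: le_min; case: (min_covering _ _) => [|q] le_min.
    by rewrite ln0// ln_nat_ge0.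
  by rewrite ler_ln ?posrE ?ltr0n ?ler_nat// (leq_trans _ le_min).
Qed.

(** * Vanishing of the limits and of the entropies *)

Lemma limn_esup_le0P (R : realType) (u : nat -> \bar R) :
  (limn_esup u <= 0)%E <->
  forall e : R, 0 < e -> exists N, forall n, (N <= n)%N -> (u n <= e%:E)%E.
Proof.
have -> : limn_esup u = ereal_inf (range (esups u)).
  by rewrite limn_esup_lim; apply/cvg_lim/cvg_esups_inf.
split=> [u_le0 e e_gt0|u_small].
  have /ereal_inf_lt[_ [N _ <-] uNe] : (ereal_inf (range (esups u)) < e%:E)%E.
    by apply: le_lt_trans u_le0 _; rewrite lte_fin.
  exists N => n Nn; apply: le_trans (ltW uNe).
  by apply: ereal_sup_ubound; exists n.
apply/lee_addgt0Pr => e /u_small[N uN]; rewrite add0e.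
apply: ge_ereal_inf; exists (esups u N); first by exists N.
by apply: ge_ereal_sup => _ [n /= Nn <-]; apply: uN.
Qed.

Lemma limn_einfE (R : realType) (u : nat -> \bar R) :
  limn_einf u = ereal_sup (range (einfs u)).
Proof. by rewrite limn_einf_lim; apply/cvg_lim/cvg_einfs_sup. Qed.

Lemma limn_einf_le0P (R : realType) (u : nat -> \bar R) :
  (limn_einf u <= 0)%E <->
  forall (e : R) N, 0 < e -> exists2 n, (N <= n)%N & (u n <= e%:E)%E.
Proof.
rewrite limn_einfE; split=> [u_le0 e N e_gt0|u_small].
  have /ereal_inf_lt[_ [n /= Nn <-] une] : (einfs u N < e%:E)%E.
    apply: le_lt_trans (_ : 0 < e%:E)%E; last by rewrite lte_fin.
    by apply: le_trans u_le0; apply: ereal_sup_ubound; exists N.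
  by exists n => //; apply: ltW.
apply: ge_ereal_sup => _ [N _ <-]; apply/lee_addgt0Pr => e e_gt0.
have [n Nn une] := u_small e N e_gt0.
by rewrite add0e; apply: ge_ereal_inf; exists (u n) => //; exists n.
Qed.

Lemma limn_einf_ge0 (R : realType) (u : nat -> \bar R) :
  (forall n, 0 <= u n)%E -> (0 <= limn_einf u)%E.
Proof.
move=> u_ge0; rewrite limn_einfE.
apply: (@le_trans _ _ (einfs u 0)); last by apply: ereal_sup_ubound; exists 0%N.
by apply: le_ereal_inf_tmp => _ [n _ <-].
Qed.

(** Some finite open cover is needed for the supremum defining an entropy to be
    nonnegative rather than -oo. *)
Lemma finite_open_cover_setT (X : topologicalType) :
  @finite_open_cover X [set setT].
Proof.
split; [exact: finite_set1 | by move=> _ ->; apply: openT|].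
by rewrite bigcup_set1.
Qed.

Lemma upper_entropy_eq0P (R : realType) (X : topologicalType) (K : set X)
    (g : nat -> X -> X) (s : R) :
  upper_entropy K g s = 0%E <->
  forall U, finite_open_cover U -> (limn_esup (cover_growth K g s U) <= 0)%E.
Proof.
split=> [h0 U covU|h_le0].
  by rewrite -h0; apply: ereal_sup_ubound; exists U.
apply/eqP; rewrite eq_le; apply/andP; split.
  by apply: ge_ereal_sup => _ [U covU <-]; apply: h_le0.
apply: le_trans (limn_einf_ge0 (cover_growth_ge0 K g s [set setT])) _.
apply: le_trans (limn_einf_sup _) _.
by apply: ereal_sup_ubound; exists [set setT] => //; apply: finite_open_cover_setT.
Qed.

Lemma lower_entropy_eq0P (R : realType) (X : topologicalType) (K : set X)
    (g : nat -> X -> X) (s : R) :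
  lower_entropy K g s = 0%E <->
  forall U, finite_open_cover U -> (limn_einf (cover_growth K g s U) <= 0)%E.
Proof.
split=> [h0 U covU|h_le0].
  by rewrite -h0; apply: ereal_sup_ubound; exists U.
apply/eqP; rewrite eq_le; apply/andP; split.
  by apply: ge_ereal_sup => _ [U covU <-]; apply: h_le0.
apply: le_trans (limn_einf_ge0 (cover_growth_ge0 K g s [set setT])) _.
by apply: ereal_sup_ubound; exists [set setT] => //; apply: finite_open_cover_setT.
Qed.

Lemma lee_scale_div (R : realType) (C e : R) (x y : \bar R) : 0 < C ->
  (x <= C%:E * y)%E -> (y <= (e / C)%:E)%E -> (x <= e%:E)%E.
Proof.
move=> C_gt0 xCy ye; apply: le_trans xCy _.
have -> : e = C * (e / C) by rewrite mulrC divfK// gt_eqF.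
by rewrite EFinM lee_pmul2l// lte_fin.
Qed.

(** * Entropies of the powers *)

Lemma upper_entropy_power_eq0 (R : realType) (X : topologicalType) (K : set X)
    (f : nat -> X -> X) (k : nat) (s : R) : (0 < k)%N -> 0 <= s ->
  upper_entropy K f s = 0%E -> upper_entropy K (nds_power f k) s = 0%E.
Proof.
move=> k_gt0 s_ge0 /upper_entropy_eq0P f0; apply/upper_entropy_eq0P => U covU.
have C_gt0 : 0 < (2 * k)%:R `^ s :> R by rewrite powR_gt0// ltr0n muln_gt0.
apply/limn_esup_le0P => e e_gt0.
have /limn_esup_le0P/(_ _ (divr_gt0 e_gt0 C_gt0))[N fN] := f0 U covU.
exists N.+1 => n Nn; have n_gt0 : (0 < n)%N by apply: leq_trans Nn.
(* The growth rate of g at time n is controlled by that of f at time n k. *)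
apply: (lee_scale_div C_gt0 (cover_growth_power K f covU s_ge0 k_gt0 n_gt0
  (m := n * k) _)).
  by rewrite leqnn leq_pmul2l// leq_pmull.
by apply: fN; apply: leq_trans (ltnW Nn) _; apply: leq_pmulr.
Qed.

(** The good times m of f cannot be chosen, so g is observed at time
    m %/ k; asking for m >= (N+1) k makes this time exceed N, hence positive,
    and for positive n = m %/ k the rounding m < (n+1) k gives m <= 2 k n. *)
Lemma lower_entropy_power_eq0 (R : realType) (X : topologicalType) (K : set X)
    (f : nat -> X -> X) (k : nat) (s : R) : (0 < k)%N -> 0 <= s ->
  lower_entropy K f s = 0%E -> lower_entropy K (nds_power f k) s = 0%E.
Proof.
move=> k_gt0 s_ge0 /lower_entropy_eq0P f0; apply/lower_entropy_eq0P => U covU.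
have C_gt0 : 0 < (2 * k)%:R `^ s :> R by rewrite powR_gt0// ltr0n muln_gt0.
apply/limn_einf_le0P => e N e_gt0.
have /limn_einf_le0P/(_ _ (N.+1 * k)%N (divr_gt0 e_gt0 C_gt0))[m Nm fm] :=
  f0 U covU.
have Nn : (N < m %/ k)%N by rewrite leq_divRL.
have n_gt0 : (0 < m %/ k)%N by apply: leq_trans Nn.
exists (m %/ k)%N; first exact: ltnW.
apply: (lee_scale_div C_gt0 (cover_growth_power K f covU s_ge0 k_gt0 n_gt0 _) fm).
rewrite leq_divM (leq_trans (ltnW (ltn_ceil m k_gt0)))//.
by rewrite mulnA leq_pmul2r// muln2 -addnn -addn1 leq_add2l.
Qed.

Theorem theorem3p7 (R : realType) (X : topologicalType) (f : nat -> X -> X)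
    (X_compact : compact [set: X]) (f_continuous : forall i, continuous (f i))
    (K : set X) (K_nonempty : K !=set0) (k : nat) (k_gt0 : (0 < k)%N) :
  (upper_entropy_dim R K (nds_power f k) <= upper_entropy_dim R K f)%E /\
  (lower_entropy_dim R K (nds_power f k) <= lower_entropy_dim R K f)%E.
Proof.
split; apply: ereal_inf_le_tmp; apply: image_subset => s [s_gt0 fs0]; split.
- exact: s_gt0.
- exact: upper_entropy_power_eq0 (ltW s_gt0) fs0.
- exact: s_gt0.
- exact: lower_entropy_power_eq0 (ltW s_gt0) fs0.
Qed.
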